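(* In a finite dynamic game as described in the context, let $K=(K^i)_{i\in\mathcal{I}}$ where, for each player $i$, $K^i$ is unilaterally sufficient information for player $i$. Then the set of payoff profiles $(J^i(\rho))_{i}$ of $K$-based sequential equilibria (sequential equilibria $(\rho,Q)$ with $\rho$ a $K$-based profile) equals the set of payoff profiles $(J^i(g))_i$ of all sequential equilibria $(g,Q)$.
   Context: Game model: finite set of players $\mathcal{I}$, times $\mathcal{T}=\{1,\dots,T\}$. At time $t$ each player $i$ takes action $U_t^i\in\mathcal{U}_t^i$, obtains reward $R_t^i\in[-1,1]$ and learns new information $Z_t^i\in\mathcal{Z}_t^i$. There is a state $X_t\in\mathcal{X}_t$ with $(X_{t+1},Z_t,R_t)=f_t(X_t,U_t,W_t)$ for fixed functions $f_t$. Primitive random variables $(X_1,H_1)$ (with $H_1=(H_1^i)_i$ initial information) and $W_1,\dots,W_T$ are mutually independent with commonly known distributions. All sets $\mathcal{X}_t,\mathcal{U}_t,\mathcal{Z}_t,\mathcal{W}_t,\mathcal{H}_1$ are finite. Perfect recall: $H_t^i=(H_1^i,Z_{1:t-1}^i)\in\mathcal{H}_t^i$, and $U_t^i$ is a component of $Z_t^i$. Behavioral strategy $g_t^i:\mathcal{H}_t^i\to\Delta(\mathcal{U}_t^i)$; payoff $J^i(g)=\mathbb{E}^g[\sum_t R_t^i]$. A realization is admissible under $g$ if it has positive probability under $g$. Sequential equilibrium (SE): for a profile $g$ and functions $Q_t^i:\mathcal{H}_t^i\times\mathcal{U}_t^i\to\mathbb{R}$: $g$ is sequentially rational under $Q$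 if $\mathrm{supp}(g_t^i(h_t^i))\subseteq\arg\max_u Q_t^i(h_t^i,u)$ for all $i,t,h_t^i$; $Q$ is fully consistent with $g$ if there is a sequence $(g^{(n)},Q^{(n)})\to(g,Q)$ with each $g^{(n)}$ fully mixed and $Q_\tau^{(n),i}(h_\tau^i,u_\tau^i)=\mathbb{E}^{g^{(n)}}[\sum_{t=\tau}^T R_t^i\mid h_\tau^i,u_\tau^i]$ for all $i,\tau,h_\tau^i,u_\tau^i$; $(g,Q)$ is an SE if both hold. Compression: $K_1^i=\iota_1^i(H_1^i)$, $K_t^i=\iota_t^i(K_{t-1}^i,Z_{t-1}^i)$ for fixed maps, finite value sets $\mathcal{K}_t^i$; $k_t^i$ is the compression of $h_t^i$; a $K^i$-based strategy has $\rho_t^i:\mathcal{K}_t^i\to\Delta(\mathcal{U}_t^i)$. Unilaterally sufficient information (USI): $K^i$ is USI for player $i$ if there exist $F_t^{i,g^i}:\mathcal{K}_t^i\to\Delta(\mathcal{H}_t^i)$ depending only on $g^i$ and $\Phi_t^{i,g^{-i}}:\mathcal{K}_t^i\to\Delta(\mathcal{X}_t\times\mathcal{H}_t^{-i})$ depending only on $g^{-i}$ with $\Pr^g(x_t,h_t\mid k_t^i)=F_t^{i,g^i}(h_t^i\mid k_t^i)\Phi_t^{i,g^{-i}}(x_t,h_t^{-i}\mid k_t^i)$ for all behavioral profiles $g$, all $t$, all $k_t^i$ admissible under $g$ (with $x_t,h_t^i,h_t^{-i}$ ranging independently; the left side is $0$ if they disagree on shared components). *)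

(* Defs.v *)
From mathcomp Require Import all_boot all_order all_algebra.
From mathcomp Require Import all_classical all_reals all_analysis.


Import Order.TTheory GRing.Theory Num.Theory.
Local Open Scope ring_scope.
Local Open Scope classical_set_scope.
Import numFieldNormedType.Exports.

(* Finite dynamic game.  Times are 0-indexed: the paper's time t in         *)
(* {1,...,T} is our time t-1 in {0,...,T-1}; the paper's X_{T+1} is our     *)
(* stateT T.  Sets indexed by times t >= horizon are irrelevant junk.       *)
Record game (R : realType) := Game {
  player : finType;
  horizon : nat;
  stateT : nat -> finType;
  actT : nat -> player -> finType;
  infoT : nat -> player -> finType;
  noiseT : nat -> finType;
  initT : player -> finType;
  dyn : forall t, stateT t -> {dffun forall i, actT t i} -> noiseT t ->
        stateT t.+1 * {dffun forall i, infoT t i} * (player -> R);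
  prior : (stateT 0 * {dffun forall i, initT i})%type -> R;
  noise_law : forall t, noiseT t -> R;
  (* perfect recall: U_t^i is a component of Z_t^i *)
  act_of : forall t i, infoT t i -> actT t i;
  prior_ge0 : forall a, 0 <= prior a;
  prior_sum1 : \sum_(a : (stateT 0 * {dffun forall i, initT i})%type) prior a = 1;
  noise_ge0 : forall t, (t < horizon)%N -> forall w, 0 <= noise_law t w;
  noise_sum1 : forall t, (t < horizon)%N -> \sum_(w : noiseT t) noise_law t w = 1;
  reward_bound : forall t, (t < horizon)%N -> forall x u w i,
      -1 <= (dyn t x u w).2 i <= 1;
  recall_act : forall t, (t < horizon)%N -> forall x u w i,
      act_of t i ((dyn t x u w).1.2 i) = u i
}.

Arguments dyn {R} g t _ _ _.
Arguments noise_law {R} g t _.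
Arguments act_of {R} g t i _.
Arguments prior {R} g _.
Arguments player {R} g.
Arguments horizon {R} g.
Arguments stateT {R} g.
Arguments actT {R} g.
Arguments infoT {R} g.
Arguments noiseT {R} g.
Arguments initT {R} g.

Set Implicit Arguments.
Unset Strict Implicit.
Unset Printing Implicit Defensive.

Section GameDefs.
Context {R : realType} (G : game R).

Notation I := (player G).
Notation T := (horizon G).

Fixpoint hist (i : I) (t : nat) : finType :=
  match t with
  | 0 => initT G i
  | t'.+1 => (hist i t' * infoT G t' i)%type
  end.

Definition uprof (t : nat) : finType := {dffun forall i : I, actT G t i}.
Definition hprof (t : nat) : finType := {dffun forall i : I, hist i t}.

Fixpoint path (t : nat) : finType :=
  match t with
  | 0 => (stateT G 0 * {dffun forall i : I, initT G i})%type
  | t'.+1 => (path t' * (noiseT G t' * uprof t'))%type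
  end.

Fixpoint state (t : nat) : path t -> stateT G t * hprof t :=
  match t with
  | 0 => fun om => (om.1, [ffun i => om.2 i])
  | t'.+1 => fun om =>
      let s := state om.1 in
      let o := dyn G t' s.1 om.2.2 om.2.1 in
      (o.1.1, [ffun i => (s.2 i, o.1.2 i)])
  end.

Definition reward_at (t : nat) (om : path t.+1) : I -> R :=
  (dyn G t (state om.1).1 om.2.2 om.2.1).2.

Definition strat (i : I) := forall t, hist i t -> actT G t i -> R.
Definition profile := forall i : I, strat i.
Definition qfun := forall (i : I) t, hist i t -> actT G t i -> R.

Definition valid_strat (i : I) (s : strat i) : Prop :=
  forall t, (t < T)%N -> forall h : hist i t,
    (forall u, 0 <= s t h u) /\ \sum_(u : actT G t i) s t h u = 1.

Definition valid_profile (g : profile) : Prop := forall i, valid_strat (g i).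

Definition fully_mixed (g : profile) : Prop :=
  valid_profile g /\
  forall i t, (t < T)%N -> forall (h : hist i t) u, 0 < g i t h u.

Fixpoint pathprob (g : profile) (t : nat) : path t -> R :=
  match t with
  | 0 => fun om => prior G om
  | t'.+1 => fun om =>
      pathprob g om.1 * noise_law G t' om.2.1 *
      \prod_(i : I) g i t' ((state om.1).2 i) (om.2.2 i)
  end.

Fixpoint rew_from (tau : nat) (t : nat) : path t -> I -> R :=
  match t with
  | 0 => fun _ _ => 0
  | t'.+1 => fun om i =>
      rew_from tau om.1 i + (if (tau <= t')%N then reward_at om i else 0)
  end.

Definition payoff (g : profile) (i : I) : R :=
  \sum_(om : path T) pathprob g om * rew_from 0 om i.

Fixpoint event_hu (i : I) (tau : nat) (h : hist i tau) (a : actT G tau i)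
    (t : nat) : path t -> bool :=
  match t with
  | 0 => fun _ => false
  | t'.+1 => fun om =>
      event_hu h a om.1 ||
      ((Tagged (hist i) ((state om.1).2 i) == Tagged (hist i) h) &&
       (Tagged (fun s => actT G s i) (om.2.2 i) == Tagged (fun s => actT G s i) a))
  end.

Definition prob_hu (g : profile) (i : I) tau (h : hist i tau) (a : actT G tau i) : R :=
  \sum_(om : path T) pathprob g om * (event_hu h a om)%:R.

Definition cond_rtg (g : profile) (i : I) tau (h : hist i tau) (a : actT G tau i) : R :=
  (\sum_(om : path T) pathprob g om * (event_hu h a om)%:R * rew_from tau om i)
  / prob_hu g h a.

Definition Q_of (g : profile) (Q : qfun) : Prop :=
  forall i tau, (tau < T)%N -> forall (h : hist i tau) (a : actT G tau i),
    0 < prob_hu g h a -> Q i tau h a = cond_rtg g h a.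

Definition seq_rational (g : profile) (Q : qfun) : Prop :=
  forall i t, (t < T)%N -> forall (h : hist i t) (u : actT G t i),
    0 < g i t h u -> forall u' : actT G t i, Q i t h u' <= Q i t h u.

Definition fully_consistent (g : profile) (Q : qfun) : Prop :=
  exists (gs : nat -> profile) (Qs : nat -> qfun),
    (forall n, fully_mixed (gs n)) /\
    (forall i t, (t < T)%N -> forall (h : hist i t) (u : actT G t i),
        (fun n => gs n i t h u) @ \oo --> g i t h u) /\
    (forall i t, (t < T)%N -> forall (h : hist i t) (u : actT G t i),
        (fun n => Qs n i t h u) @ \oo --> Q i t h u) /\
    (forall n, Q_of (gs n) (Qs n)).

Definition seq_eq (g : profile) (Q : qfun) : Prop :=
  valid_profile g /\ seq_rational g Q /\ fully_consistent g Q.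

End GameDefs.

Arguments hist {R} G i t.
Arguments path {R} G t.
Arguments hprof {R} G t.
Arguments uprof {R} G t.
Arguments strat {R} G i.

Record compression (R : realType) (G : game R) := Compression {
  cinfo : player G -> nat -> finType;
  iota0 : forall i, initT G i -> cinfo i 0;
  iotaS : forall i t, cinfo i t -> infoT G t i -> cinfo i t.+1
}.

Section Compression.
Context {R : realType} {G : game R} (K : compression G).

Notation I := (player G).
Notation T := (horizon G).

Fixpoint comp (i : I) (t : nat) : hist G i t -> cinfo K i t :=
  match t return hist G i t -> cinfo K i t with
  | 0 => fun h => @iota0 R G K i h
  | t'.+1 => fun h => @iotaS R G K i t' (comp h.1) h.2
  end.

Definition K_based (g : profile G) : Prop :=
  exists rho : forall (i : I) t, cinfo K i t -> actT G t i -> R,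
    forall i t, (t < T)%N -> forall (h : hist G i t) (u : actT G t i),
      g i t h u = rho i t (comp h) u.

Definition others (i : I) : finType := {j : I | j != i}.
Definition hist_others (i : I) (t : nat) : finType :=
  {dffun forall j : others i, hist G (val j) t}.
Definition minus (i : I) (t : nat) (h : hprof G t) : hist_others i t :=
  [ffun j : others i => h (val j)].

Definition prob_k (g : profile G) (i : I) t (k : cinfo K i t) : R :=
  \sum_(om : path G t) pathprob g om * (comp ((state om).2 i) == k)%:R.

Definition condprob_xh (g : profile G) (i : I) t (k : cinfo K i t)
    (x : stateT G t) (h : hprof G t) : R :=
  (\sum_(om : path G t) pathprob g om *
      ((state om == (x, h)) && (comp ((state om).2 i) == k))%:R)
  / prob_k g k.

Definition USI (i : I) : Prop :=
  exists (F : strat G i -> forall t, cinfo K i t -> hist G i t -> R)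
         (Phi : profile G -> forall t, cinfo K i t -> stateT G t ->
                  hist_others i t -> R),
    (forall g g' : profile G, (forall j, j != i -> g j = g' j) -> Phi g = Phi g') /\
    (forall s : strat G i, valid_strat s -> forall t, (t < T)%N ->
       forall k, (forall h, 0 <= F s t k h) /\ \sum_(h : hist G i t) F s t k h = 1) /\
    (forall g : profile G, valid_profile g -> forall t, (t < T)%N ->
       forall k, (forall x hm, 0 <= Phi g t k x hm) /\
       \sum_(x : stateT G t) \sum_(hm : hist_others i t) Phi g t k x hm = 1) /\
    (forall g : profile G, valid_profile g -> forall t, (t < T)%N ->
       forall k : cinfo K i t, 0 < prob_k g k ->
       forall (x : stateT G t) (h : hprof G t),
         condprob_xh g k x h = F (g i) t k (h i) * Phi g t k x (minus i h)).

End Compression.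

(* Main.v *)
(* Replace the players' strategies one at a time.  Given fully mixed profiles *)
(* [gs n] converging to the equilibrium [g], player [i]'s strategy is         *)
(* replaced by its average [rho_n(a | k) = \sum_h F(h | k) * gs_n(a | h)] over *)
(* the histories compressed to [k].  The factorization defining USI makes     *)
(* [h_i] and [(x, h_{-i})] conditionally independent given [k_i], so this     *)
(* preserves the joint law of [(x_t, h_t^{-i}, k_t^i, u_t, w_t)]: all payoffs, *)
(* and all conditional rewards-to-go of the other players, are unchanged.     *)
(* For player [i] the belief [Phi(x, h_{-i} | k_i)], hence the transition     *)
(* kernel of her decision problem, depends on her history only through [k_i]  *)
(* and is not affected by the replacement.  By backward induction the limit   *)
(* value [Q(h, .)] depends only on the compression of [h], so the limit [rho] *)
(* of a convergent subsequence of the [rho_n] is supported on maximizers and  *)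
(* the new values converge to the same [Q].  At histories that nature never   *)
(* reaches the values are unconstrained and are set to 0.                     *)

Require Import Defs.
From mathcomp Require Import all_boot all_order all_algebra.
From mathcomp Require Import all_classical all_reals all_analysis.
(* Imported again because the libraries above shadow [path] and [comp]. *)
Require Import Defs.
Import Order.TTheory GRing.Theory Num.Theory numFieldNormedType.Exports.

Set Implicit Arguments.
Unset Strict Implicit.
Unset Printing Implicit Defensive.

(** Only one inclusion needs an argument, and [K_based_replacement] is its one-player case. Two
    facts carry it. First, test functions of [(k_i, x, h_{-i})] cannot tell [g i] from its average
    [mixed] ([expect_mixed]), and this triple together with the actions and the noise determines the
    next one. So [replace_law] and [replace_law_act] keep its law, which gives [replace_payoff] and,
    for the other players, [replace_cond_rtg]. Second, [cond_rtgE] turns player [i]'s conditional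
    reward-to-go into a dynamic program whose reward and transition terms read only [k_i] and the
    other players' strategies ([qvalueE], [eq_kern]).

    Along the sequence [gs n] the continuation values may still differ between histories with the
    same compression. They agree only in the limit, because any two action laws supported on
    maximizers of the same [Q] have the same mean ([argmax_mean_eq]). [values_agree_all] is this
    backward induction, and [seq_eq_replaced] assembles the new equilibrium. *)

Section Generalities.
Local Open Scope ring_scope.
Local Open Scope classical_set_scope.
Context {R : realType}.

(** * Finite sums, limits of real sequences and maximizers *)

Lemma sum_dffun_prod (I : finType) (A : I -> finType) (f : forall i, A i -> R) :
  \sum_(u : {dffun forall i, A i}) \prod_(i : I) f i (u i) =
  \prod_(i : I) \sum_(a : A i) f i a.
Proof.
pose P i : {ffun A i -> R} := [ffun a => f i a].
rewrite (reindex (@dffun_of_fprod I A)) /=; last first.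
  exact/onW_bij/dffun_of_fprod_bij.
transitivity (\sum_(t : fprod A) \prod_(i in I) P i (t i)).
  by apply: eq_bigr => t _; apply: eq_bigr => i _; rewrite !ffunE.
(* A dependent choice becomes an ordinary function into the tagged sum of all the [A i], where the
   usual distributivity law applies. *)
rewrite big_fprod -(bigA_distr_big_dep _ (fun i j => untag 0 (P i) j)).
apply: eq_bigr => i _; rewrite (big_tag (fun i a => f i a)).
apply: eq_bigr => j _; case: (tag j =P i) => [e|ne].
  by rewrite /untag; case: eqP => // e'; rewrite ffunE.
by rewrite /untag; case: eqP.
Qed.

Lemma cvg_bigsum (J : finType) (P : pred J) (u : J -> nat -> R) (l : J -> R) :
  (forall j, P j -> u j @ \oo --> l j) ->
  (fun n => \sum_(j | P j) u j n) @ \oo --> \sum_(j | P j) l j.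
Proof. by move=> h; apply: cvg_big => //; exact: add_continuous. Qed.

Lemma cvg_bigsum0 (J : finType) (u : J -> nat -> R) :
  (forall j, u j @ \oo --> (0 : R)) ->
  (fun n => \sum_j u j n) @ \oo --> (0 : R).
Proof.
move=> u0; have := cvg_bigsum (fun j (_ : xpredT j) => u0 j).
by rewrite [X in _ --> X -> _]big1.
Qed.

Lemma cvg_bigprod (J : finType) (P : pred J) (u : J -> nat -> R) (l : J -> R) :
  (forall j, P j -> u j @ \oo --> l j) ->
  (fun n => \prod_(j | P j) u j n) @ \oo --> \prod_(j | P j) l j.
Proof. by move=> h; apply: cvg_big => //; exact: mul_continuous. Qed.

(** The subsequence is refined once for each element of [X]; limits already obtained survive every
    further refinement. *)
Lemma bolzano_weierstrass_fin (X : finType) (u : X -> nat -> R) :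
  (forall x, bounded_fun (u x)) ->
  exists2 f : nat -> nat, f @ \oo --> \oo &
    exists l : X -> R, forall x, (u x \o f) @ \oo --> l x.
Proof.
move=> ub.
suff [f fi fl] : exists2 f : nat -> nat, f @ \oo --> \oo &
    forall x, x \in enum X -> cvgn (u x \o f).
  exists f => //; exists (fun x => limn (u x \o f)) => x.
  by apply: fl; rewrite mem_enum.
elim: (enum X) => [|x s [f fi fl]]; first by exists id => //; exact: cvg_id.
have [|f' fi' fl'] := @bolzano_weierstrass R (u x \o f).
  have [N [Nr hN]] := ub x; exists N; split => // y Ny z _.
  exact: hN.
have {}fi' : f' @ \oo --> \oo.
  have le_f' n : (n <= f' n)%N.
    elim: n => // n IHn; apply: (leq_ltn_trans IHn).
    by rewrite ltnNge -leEnat fi' -ltnNge.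
  apply/cvgnyPge => N; near=> n; apply: leq_trans (le_f' n).
  by near: n; exact: nbhs_infty_ge.
exists (f \o f') => [|y]; first exact: cvg_comp fi' fi.
rewrite inE => /predU1P[->//|ys].
have /cvg_ex[l yl] := fl _ ys.
by apply/cvg_ex; exists l; exact: cvg_comp fi' yl.
Unshelve. all: by end_near.
Qed.

Lemma cvg_seq_unique (u : nat -> R) (l l' : R) :
  u @ \oo --> l -> u @ \oo --> l' -> l = l'.
Proof. exact: norm_cvg_unique. Qed.

Lemma cvg_seq_ge0 (u : nat -> R) (l : R) :
  (forall n, 0 <= u n) -> u @ \oo --> l -> 0 <= l.
Proof.
move=> u0; apply: (closed_cvg (fun x : R => 0 <= x)); first exact: closed_ge.
exact: nearW.
Qed.

Lemma cvg_bounded_mul0 (b d : nat -> R) (C : R) :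
  (forall n, 0 <= b n <= C) -> d @ \oo --> (0 : R) ->
  (fun n => b n * d n) @ \oo --> (0 : R).
Proof.
move=> bC d0; apply: norm_cvg0.
have Cd0 : (fun n => C * `|d n|) @ \oo --> (0 : R).
  rewrite -(mulr0 C); apply: cvgM; first exact: cvg_cst.
  by rewrite -(normr0 R); apply: cvg_norm.
have bd : \forall n \near \oo, (0 : R) <= `|b n * d n| <= C * `|d n|.
  apply: nearW => n; have /andP[b0 bn] := bC n.
  by rewrite normr_ge0 normrM ger0_norm// ler_wpM2r.
by apply: (squeeze_cvgr bd) => //; exact: cvg_cst.
Qed.

(* Both sides equal the maximum of [q]. *)
Lemma argmax_mean_eq (A : finType) (q p p' : A -> R) :
  (forall a, 0 <= p a) -> (forall a, 0 <= p' a) ->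
  \sum_a p a = 1 -> \sum_a p' a = 1 ->
  (forall a, 0 < p a -> forall b, q b <= q a) ->
  (forall a, 0 < p' a -> forall b, q b <= q a) ->
  \sum_a p a * q a = \sum_a p' a * q a.
Proof.
move=> p0 p'0 p1 p'1 pm p'm.
have pos (r : A -> R) : (forall a, 0 <= r a) -> \sum_a r a = 1 ->
    exists a, 0 < r a.
  move=> r0 r1; apply: contrapT => /forallNP h.
  have : \sum_a r a = 0.
    by apply: big1 => a _; apply/eqP; rewrite eq_le r0 leNgt andbT; apply/negP/h.
  by move/eqP; rewrite r1 oner_eq0.
have [a pa] := pos _ p0 p1.
have E (r : A -> R) : (forall a, 0 <= r a) -> \sum_a r a = 1 ->
    (forall a, 0 < r a -> forall b, q b <= q a) -> \sum_a r a * q a = q a.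
  move=> r0 r1 rm; rewrite -[RHS]mul1r -r1 mulr_suml; apply: eq_bigr => b _.
  have := r0 b; rewrite le_eqVlt => /predU1P[<-|rb]; first by rewrite !mul0r.
  by congr (_ * _); apply/eqP; rewrite eq_le pm// rm.
by rewrite !E.
Qed.

End Generalities.

(** * Expectations over paths *)

Section Games.
Local Open Scope ring_scope.
Local Open Scope classical_set_scope.
Context {R : realType} {G : game R}.
Notation I := (player G).
Notation T := (horizon G).

Definition expect (g : profile G) t (f : path G t -> R) : R :=
  \sum_(om : path G t) pathprob g om * f om.

Lemma eq_expect g t (f f' : path G t -> R) :
  (forall om, f om = f' om) -> expect g f = expect g f'.
Proof. by move=> ff'; apply: eq_bigr => om _; rewrite ff'. Qed.

Lemma expectD g t (f f' : path G t -> R) :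
  expect g (fun om => f om + f' om) = expect g f + expect g f'.
Proof. by rewrite -big_split; apply: eq_bigr => om _; rewrite mulrDr. Qed.

Lemma expectZr g t (f : path G t -> R) c :
  expect g (fun om => f om * c) = expect g f * c.
Proof. by rewrite /expect mulr_suml; apply: eq_bigr => om _; rewrite mulrA. Qed.

Lemma expect_sum g t (J : finType) (P : pred J) (f : J -> path G t -> R) :
  expect g (fun om => \sum_(j | P j) f j om) = \sum_(j | P j) expect g (f j).
Proof.
by rewrite exchange_big; apply: eq_bigr => om _; rewrite mulr_sumr.
Qed.

Lemma expectS g t (f : path G t.+1 -> R) :
  expect g f = expect g (fun om => \sum_(w : noiseT G t) \sum_(u : uprof G t)
    noise_law G t w * \prod_j g j t ((state om).2 j) (u j) * f (om, (w, u))).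
Proof.
transitivity (\sum_(om : path G t) \sum_(p : noiseT G t * uprof G t)
    pathprob g om * noise_law G t p.1 *
    \prod_j g j t ((state om).2 j) (p.2 j) * f (om, p)).
  by rewrite pair_bigA; apply: eq_bigr => -[om [w u]] _.
apply: eq_bigr => om _; rewrite pair_bigA mulr_sumr.
by apply: eq_bigr => -[w u] _ /=; rewrite !mulrA.
Qed.

Lemma pathprob_ge0 g t (om : path G t) :
  valid_profile g -> (t <= T)%N -> 0 <= pathprob g om.
Proof.
move=> vg; elim: t om => [|t IHt] om tT; first exact: prior_ge0.
rewrite /= !mulr_ge0 ?IHt ?noise_ge0 ?(ltnW tT)//.
by apply: prodr_ge0 => i _; have [] := vg i t tT ((state om.1).2 i).
Qed.

Lemma expect_ge0 g t (f : path G t -> R) : valid_profile g -> (t <= T)%N ->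
  (forall om, 0 <= f om) -> 0 <= expect g f.
Proof. by move=> vg tT f0; apply: sumr_ge0 => om _; rewrite mulr_ge0 ?pathprob_ge0. Qed.

(** Integrates out one stage: the noise has mass 1 and the players randomize independently, so the
    sum over joint actions factors by [sum_dffun_prod]. *)
Lemma expect_act g t (f : path G t -> R) (c : forall i, actT G t i -> R) :
  (t < T)%N ->
  expect g (fun om : path G t.+1 => f om.1 * \prod_i c i (om.2.2 i)) =
  expect g (fun om => f om * \prod_i \sum_a g i t ((state om).2 i) a * c i a).
Proof.
move=> tT; rewrite expectS; apply: eq_expect => om.
transitivity (\sum_(w : noiseT G t) noise_law G t w *
    (f om * \prod_j \sum_a g j t ((state om).2 j) a * c j a)).
  apply: eq_bigr => w _.
  rewrite -(sum_dffun_prod (fun j a => g j t ((state om).2 j) a * c j a)) !mulr_sumr.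
  apply: eq_bigr => u _; rewrite big_split /= -!mulrA; congr (_ * _).
  by rewrite mulrCA.
by rewrite -mulr_suml noise_sum1// mul1r.
Qed.

Lemma expect_marginal g t (f : path G t -> R) : valid_profile g -> (t < T)%N ->
  expect g (fun om : path G t.+1 => f om.1) = expect g f.
Proof.
move=> vg tT; have := expect_act g f (fun i _ => 1) tT.
under eq_expect => om do rewrite big1// mulr1.
move=> ->; apply: eq_expect => om; rewrite big1 ?mulr1// => i _.
by under eq_bigr do rewrite mulr1; have [] := vg i t tT ((state om).2 i).
Qed.

Lemma expect_marginal_act g t (f : path G t -> R) i (a : actT G t i) :
  valid_profile g -> (t < T)%N ->
  expect g (fun om : path G t.+1 => f om.1 * (om.2.2 i == a)%:R) =
  expect g (fun om => f om * g i t ((state om).2 i) a).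
Proof.
move=> vg tT.
(* Player [i]'s action is tested against the indicator of [a], every other action against 1. *)
pose c := @dfwith I (fun j => actT G t j -> R) (fun j _ => 1) i (fun b => (b == a)%:R).
have ci b : c i b = (b == a)%:R by rewrite /c dfwithin.
have cj j b : j != i -> c j b = 1 by move=> ji; rewrite /c dfwithout// eq_sym.
transitivity (expect g (fun om : path G t.+1 => f om.1 * \prod_j c j (om.2.2 j))).
  apply: eq_expect => om; rewrite (bigD1 i)//= ci big1 ?mulr1// => j ji.
  by rewrite cj.
rewrite expect_act//; apply: eq_expect => om; congr (_ * _).
rewrite (bigD1 i)//= [X in _ * X]big1 ?mulr1 => [|j ji].
  rewrite (bigD1 a)//= ci eqxx mulr1 big1 ?addr0// => b /negPf ba.
  by rewrite ci ba mulr0.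
under eq_bigr do rewrite cj// mulr1.
by have [] := vg j t tT ((state om).2 j).
Qed.

(** * Separating one player's history and action from the others' *)

Section OnePlayer.
Context (i : I).

Definition others_prob (g : profile G) t (hm : hist_others i t) (u : uprof G t) : R :=
  \prod_(j : others i) g (val j) t (hm j) (u (val j)).

Lemma prod_others g t (h : hprof G t) (u : uprof G t) :
  \prod_j g j t (h j) (u j) = g i t (h i) (u i) * others_prob g (minus i h) u.
Proof.
rewrite (bigD1 i)//=; congr (_ * _).
have := @big_sub_cond _ 1 _ I [pred j | j != i] predT (fun j => g j t (h j) (u j)).
move=> /(_ *%R) E.
rewrite (eq_bigl (fun j => (j \in [pred j | j != i]) && predT j)) => [|j]; last by rewrite inE andbT.
rewrite E; apply: eq_bigr => j _; by rewrite ffunE.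
Qed.

Fact neqT (j : I) : j <> i -> j != i.
Proof. by move/eqP. Qed.

Lemma expectS_others g t (f : path G t.+1 -> R) :
  expect g f = expect g (fun om => \sum_(w : noiseT G t) \sum_(u : uprof G t)
    noise_law G t w * (g i t ((state om).2 i) (u i) *
    others_prob g (minus i (state om).2) u) * f (om, (w, u))).
Proof.
rewrite expectS; apply: eq_expect => om; apply: eq_bigr => w _.
by apply: eq_bigr => u _; rewrite prod_others.
Qed.

(** Inverse to splitting a history profile into [h i] and [minus i h]; [sum_hprof] reindexes along
    this bijection. *)
Definition glue t (hi : hist G i t) (hm : hist_others i t) : hprof G t :=
  [ffun j => match j =P i with
             | ReflectT e => ecast k (hist G k t) (esym e) hi
             | ReflectF ne => hm (exist _ j (neqT ne))
             end].

Lemma glue_self t (hi : hist G i t) hm : glue hi hm i = hi.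
Proof. by rewrite ffunE; case: eqP => // e; rewrite eq_axiomK. Qed.

Lemma minus_glue t (hi : hist G i t) hm : minus i (glue hi hm) = hm.
Proof.
apply/ffunP => -[j p]; rewrite !ffunE /=; case: eqP => [e|ne].
  by exfalso; rewrite e eqxx in p.
by rewrite (bool_irrelevance (neqT ne) p).
Qed.

Lemma glueK t (h : hprof G t) : glue (h i) (minus i h) = h.
Proof.
apply/ffunP => j; rewrite ffunE; case: eqP => [e|ne]; last by rewrite ffunE.
by case: _ / e.
Qed.

Lemma sum_hprof t (f : hist G i t -> hist_others i t -> R) :
  \sum_(h : hprof G t) f (h i) (minus i h) = \sum_hi \sum_hm f hi hm.
Proof.
rewrite pair_bigA (reindex (fun h : hprof G t => (h i, minus i h)))//=.
exists (fun p => glue p.1 p.2) => [h _|[hi hm] _] /=; first exact: glueK.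
by rewrite glue_self minus_glue.
Qed.

Lemma eq_others_prob (g g' : profile G) : (forall j, j != i -> g j = g' j) ->
  forall t (hm : hist_others i t) u, others_prob g hm u = others_prob g' hm u.
Proof. by move=> gg' t hm u; apply: eq_bigr => -[j ji] _; rewrite gg'. Qed.

End OnePlayer.
End Games.

(** * Beliefs under sufficient information *)

Section Events.
Local Open Scope ring_scope.
Context {R : realType} {G : game R}.
Notation I := (player G).
Notation T := (horizon G).

Lemma Tagged_neq (A : eqType) (P : A -> eqType) (s t : A) (x : P s) (y : P t) :
  s != t -> (Tagged P x == Tagged P y) = false.
Proof. by move=> st; apply/negbTE; apply: contra st => /eqP/(congr1 tag)/= ->. Qed.

Context (j : I) (tau : nat) (h : hist G j tau) (a : actT G tau j).

(* By perfect recall, the event is already recorded in player [j]'s history. *)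
Fixpoint hist_event (t : nat) : hist G j t -> bool :=
  match t with
  | 0 => fun _ => false
  | t'.+1 => fun h' =>
      hist_event h'.1 ||
      ((Tagged (hist G j) h'.1 == Tagged (hist G j) h) &&
       (Tagged (fun s => actT G s j) (act_of G t' j h'.2) ==
        Tagged (fun s => actT G s j) a))
  end.

Lemma event_huE t (om : path G t) :
  (t <= T)%N -> event_hu h a om = hist_event ((state om).2 j).
Proof.
elim: t om => // t IHt om tT /=.
by rewrite ffunE /= recall_act// IHt// ltnW.
Qed.

Lemma event_hu_early t (om : path G t) : (t <= tau)%N -> event_hu h a om = false.
Proof.
elim: t om => // t IHt om ttau /=.
by rewrite IHt ?(ltnW ttau)// Tagged_neq// neq_ltn ttau.
Qed.

Lemma event_hu_now (om : path G tau.+1) :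
  event_hu h a om = ((state om.1).2 j == h) && (om.2.2 j == a).
Proof. by rewrite /= event_hu_early// !eq_Tagged. Qed.

(** An event about stage [tau] is decided by paths of length [tau.+1], so extending such a path does
    not change it. *)
Lemma event_hu_late t (om : path G t.+1) :
  (tau < t)%N -> event_hu h a om = event_hu h a om.1.
Proof. by move=> ttau /=; rewrite Tagged_neq ?orbF// neq_ltn ttau orbT. Qed.

Lemma rew_from_early t (om : path G t) k : (t <= tau)%N -> rew_from tau om k = 0.
Proof.
elim: t om => // t IHt om ttau /=.
by rewrite IHt ?(ltnW ttau)// leqNgt ttau addr0.
Qed.

End Events.

(** * Conditional expectations from the USI factorization *)

Section SufficientInformation.
Local Open Scope ring_scope.
Local Open Scope classical_set_scope.
Context {R : realType} {G : game R} (K : compression G) (i : player G).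
Notation I := (player G).
Notation T := (horizon G).

(** The body of [USI] with its witnesses exposed, so that one choice of [F] and [Phi] serves all the
    lemmas. *)
Definition USI_with (F : strat G i -> forall t, cinfo K i t -> hist G i t -> R)
    (Phi : profile G -> forall t, cinfo K i t -> stateT G t -> hist_others i t -> R) :=
  (forall g g' : profile G, (forall j, j != i -> g j = g' j) -> Phi g = Phi g') /\
  (forall s : strat G i, valid_strat s -> forall t, (t < T)%N ->
     forall k, (forall h, 0 <= F s t k h) /\ \sum_(h : hist G i t) F s t k h = 1) /\
  (forall g : profile G, valid_profile g -> forall t, (t < T)%N ->
     forall k, (forall x hm, 0 <= Phi g t k x hm) /\
     \sum_(x : stateT G t) \sum_(hm : hist_others i t) Phi g t k x hm = 1) /\
  (forall g : profile G, valid_profile g -> forall t, (t < T)%N ->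
     forall k : cinfo K i t, 0 < prob_k g k ->
     forall (x : stateT G t) (h : hprof G t),
       condprob_xh g k x h = F (g i) t k (h i) * Phi g t k x (minus i h)).

Context (F : strat G i -> forall t, cinfo K i t -> hist G i t -> R)
  (Phi : profile G -> forall t, cinfo K i t -> stateT G t -> hist_others i t -> R)
  (FPhi : USI_with F Phi).

Lemma Phi_eq g g' : (forall j, j != i -> g j = g' j) -> Phi g = Phi g'.
Proof. by have [h _] := FPhi; exact: h. Qed.

Lemma F_ge0 s t k h : valid_strat s -> (t < T)%N -> 0 <= @F s t k h.
Proof. by have [_ [f _]] := FPhi => vs tT; have [] := f s vs t tT k. Qed.

Lemma F_sum1 s t k : valid_strat s -> (t < T)%N -> \sum_h @F s t k h = 1.
Proof. by have [_ [f _]] := FPhi => vs tT; have [] := f s vs t tT k. Qed.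

Lemma F_le1 s t k h : valid_strat s -> (t < T)%N -> @F s t k h <= 1.
Proof.
move=> vs tT; rewrite -(F_sum1 k vs tT) (bigD1 h)//= lerDl.
by apply: sumr_ge0 => *; exact: F_ge0.
Qed.

Lemma Phi_ge0 g t k x hm : valid_profile g -> (t < T)%N -> 0 <= @Phi g t k x hm.
Proof. by have [_ [_ [f _]]] := FPhi => vg tT; have [] := f g vg t tT k. Qed.

Lemma Phi_sum1 g t k : valid_profile g -> (t < T)%N ->
  \sum_x \sum_hm @Phi g t k x hm = 1.
Proof. by have [_ [_ [f _]]] := FPhi => vg tT; have [] := f g vg t tT k. Qed.

(** The USI factorization in integrated form; multiplying by [prob_k g k] clears the denominator, so
    compressions of probability zero are covered too. *)
Lemma expect_comp g t (k : cinfo K i t)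
    (psi : hist G i t -> stateT G t -> hist_others i t -> R) :
  valid_profile g -> (t < T)%N ->
  expect g (fun om => (comp K ((state om).2 i) == k)%:R *
    psi ((state om).2 i) (state om).1 (minus i (state om).2)) =
  prob_k g k * \sum_h F (g i) k h * \sum_x \sum_hm Phi g k x hm * psi h x hm.
Proof.
move=> vg tT; have [pk0|pk0] := eqVneq (prob_k g k) 0.
  rewrite pk0 mul0r; apply: big1 => om _; rewrite mulrA.
  by rewrite (psumr_eq0P _ pk0) ?mul0r// => om' _; rewrite mulr_ge0 ?(pathprob_ge0 _ vg (ltnW tT)).
have pkgt0 : 0 < prob_k g k.
  rewrite lt_neqAle eq_sym pk0 sumr_ge0// => om _.
  by rewrite mulr_ge0 ?(pathprob_ge0 _ vg (ltnW tT)).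
transitivity (\sum_(p : stateT G t * hprof G t)
    prob_k g k * condprob_xh g k p.1 p.2 * psi (p.2 i) p.1 (minus i p.2)).
  under [RHS]eq_bigr => p _ do rewrite mulrC mulrC /condprob_xh mulrCA mulfV// mulr1 mulr_suml.
  rewrite exchange_big; apply: eq_bigr => om _ /=.
  rewrite (bigD1 (state om))//= -surjective_pairing eqxx /= big1 ?addr0 ?mulrA//.
  by move=> p /negPf; rewrite -surjective_pairing eq_sym => ->; rewrite mulr0 mul0r.
rewrite mulr_sumr -(pair_bigA _ (fun x h =>
  prob_k g k * condprob_xh g k x h * psi (h i) x (minus i h))) /=.
transitivity (\sum_x \sum_h \sum_hm
    prob_k g k * (F (g i) k h * (Phi g k x hm * psi h x hm))).
  apply: eq_bigr => x _; rewrite -sum_hprof; apply: eq_bigr => h _.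
  by have [_ [_ [_ ->]]] := FPhi => //; rewrite !mulrA.
rewrite exchange_big; apply: eq_bigr => h _ /=; rewrite !mulr_sumr.
by apply: eq_bigr => x _; rewrite !mulr_sumr.
Qed.

Lemma expect_split g t (f : path G t -> R) :
  expect g f = \sum_(k : cinfo K i t)
    expect g (fun om => (comp K ((state om).2 i) == k)%:R * f om).
Proof.
rewrite -expect_sum; apply: eq_expect => om.
rewrite (bigD1 (comp K ((state om).2 i)))//= eqxx mul1r big1 ?addr0// => k.
by rewrite eq_sym => /negPf ->; rewrite mul0r.
Qed.

(* The belief of player [i] about [(x, h_{-i})] given [h_i] is [Phi(. | k_i)]. *)
Lemma expect_belief g t (psi : hist G i t -> stateT G t -> hist_others i t -> R) :
  valid_profile g -> (t < T)%N ->
  expect g (fun om => psi ((state om).2 i) (state om).1 (minus i (state om).2)) =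
  expect g (fun om => \sum_x \sum_hm Phi g (comp K ((state om).2 i)) x hm *
    psi ((state om).2 i) x hm).
Proof.
move=> vg tT; rewrite expect_split [RHS]expect_split; apply: eq_bigr => k _.
rewrite expect_comp//.
transitivity (expect g (fun om => (comp K ((state om).2 i) == k)%:R *
    \sum_x \sum_hm Phi g k x hm * psi ((state om).2 i) x hm)).
  rewrite (expect_comp k (fun h _ _ => \sum_x \sum_hm Phi g k x hm * psi h x hm))//.
  congr (_ * _); apply: eq_bigr => h _; congr (_ * _).
  under [RHS]eq_bigr do rewrite -mulr_suml.
  by rewrite -mulr_suml Phi_sum1// mul1r.
by apply: eq_expect => om; case: eqP => [->|]; rewrite ?mul0r.
Qed.

(** The mean of [f] in player [i]'s decision problem at [k] when she plays [a]: the state and the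
    others' histories follow [Phi], the others act by [g], the noise by its law. By [eq_kern] it is
    insensitive to [g i]. *)
Definition kern (g : profile G) t (k : cinfo K i t) (a : actT G t i)
    (f : stateT G t -> uprof G t -> noiseT G t -> R) : R :=
  \sum_x \sum_hm Phi g k x hm * \sum_w \sum_(u : uprof G t | u i == a)
    noise_law G t w * others_prob g hm u * f x u w.

Lemma eq_kern_fun g t (k : cinfo K i t) a f f' :
  (forall x (u : uprof G t) w, u i = a -> f x u w = f' x u w) ->
  kern g k a f = kern g k a f'.
Proof.
move=> ff'; apply: eq_bigr => x _; apply: eq_bigr => hm _; congr (_ * _).
by apply: eq_bigr => w _; apply: eq_bigr => u /eqP ua; rewrite ff'.
Qed.

Lemma eq_kern g g' t (k : cinfo K i t) a f : (forall j, j != i -> g j = g' j) ->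
  kern g k a f = kern g' k a f.
Proof.
move=> gg'; apply: eq_bigr => x _; apply: eq_bigr => hm _; rewrite (Phi_eq gg').
congr (_ * _); apply: eq_bigr => w _; apply: eq_bigr => u _.
by rewrite (eq_others_prob gg').
Qed.

Lemma expect_kern g t (f : hist G i t -> stateT G t -> uprof G t -> noiseT G t -> R) :
  valid_profile g -> (t < T)%N ->
  expect g (fun om : path G t.+1 =>
    f ((state om.1).2 i) (state om.1).1 om.2.2 om.2.1) =
  expect g (fun om => \sum_a g i t ((state om).2 i) a *
    kern g (comp K ((state om).2 i)) a (f ((state om).2 i))).
Proof.
move=> vg tT; rewrite (expectS_others i).
rewrite (expect_belief (fun h x hm => \sum_w \sum_(u : uprof G t)
  noise_law G t w * (g i t h (u i) * others_prob g hm u) * f h x u w))//.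
apply: eq_expect => om /=; set h := (state om).2 i.
under [RHS]eq_bigr do rewrite mulr_sumr.
rewrite [RHS]exchange_big; apply: eq_bigr => x _ /=.
under [RHS]eq_bigr do rewrite mulr_sumr.
rewrite [RHS]exchange_big; apply: eq_bigr => hm _ /=.
under [RHS]eq_bigr do rewrite mulrCA mulr_sumr.
rewrite -mulr_sumr [in RHS]exchange_big; congr (_ * _); apply: eq_bigr => w _ /=.
rewrite (partition_big (fun u : uprof G t => u i) predT)//=.
apply: eq_bigr => a _; rewrite mulr_sumr; apply: eq_bigr => u /eqP <-.
by rewrite !mulrA [noise_law _ _ _ * _]mulrC.
Qed.

(** The conditional law of player [i]'s action given [k], as [F] is that of her history. *)
Definition mixed (s : strat G i) t (k : cinfo K i t) (a : actT G t i) : R :=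
  \sum_h F s k h * s t h a.

(** Given [k], the history of player [i] is independent of the state and the others' histories, so
    her action probability may be averaged separately. *)
Lemma expect_mixed g t (a : actT G t i)
    (phi : cinfo K i t -> stateT G t -> hist_others i t -> R) :
  valid_profile g -> (t < T)%N ->
  expect g (fun om => g i t ((state om).2 i) a *
    phi (comp K ((state om).2 i)) (state om).1 (minus i (state om).2)) =
  expect g (fun om => mixed (g i) (comp K ((state om).2 i)) a *
    phi (comp K ((state om).2 i)) (state om).1 (minus i (state om).2)).
Proof.
move=> vg tT; rewrite expect_split [RHS]expect_split; apply: eq_bigr => k _.
transitivity (expect g (fun om => (comp K ((state om).2 i) == k)%:R *
    (g i t ((state om).2 i) a * phi k (state om).1 (minus i (state om).2)))).
  by apply: eq_expect => om; case: eqP => [->|]; rewrite ?mul0r.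
transitivity (expect g (fun om => (comp K ((state om).2 i) == k)%:R *
    (mixed (g i) k a * phi k (state om).1 (minus i (state om).2)))); last first.
  by apply: eq_expect => om; case: eqP => [->|]; rewrite ?mul0r.
rewrite (expect_comp k (fun h x hm => g i t h a * phi k x hm))//.
rewrite (expect_comp k (fun h x hm => mixed (g i) k a * phi k x hm))//.
congr (_ * _).
have E c : \sum_x \sum_hm Phi g k x hm * (c * phi k x hm) =
    c * \sum_x \sum_hm Phi g k x hm * phi k x hm.
  rewrite mulr_sumr; apply: eq_bigr => x _; rewrite mulr_sumr.
  by apply: eq_bigr => hm _; rewrite mulrCA.
under eq_bigr do rewrite E mulrA.
under [RHS]eq_bigr do rewrite E.
by rewrite -!mulr_suml F_sum1// mul1r.
Qed.

(** * Invariance of the law under averaging player [i]'s strategy *)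

Section Replacement.
Context (g g' : profile G) (vg : valid_profile g)
  (g'_others : forall j, j != i -> g' j = g j)
  (g'_self : forall t h a, (t < T)%N -> g' i t h a = mixed (g i) (comp K h) a).

Arguments g : clear implicits.
Arguments g' : clear implicits.

(** [g'] plays [mixed], a function of [k_i]; the assumed equality of laws moves the whole expression
    from [g'] to [g], and [expect_mixed] turns [mixed] back into [g i]. *)
Let law_step t : (t < T)%N ->
  (forall phi : cinfo K i t -> stateT G t -> hist_others i t -> R,
    expect g' (fun om => phi (comp K ((state om).2 i)) (state om).1 (minus i (state om).2)) =
    expect g (fun om => phi (comp K ((state om).2 i)) (state om).1 (minus i (state om).2))) ->
  forall phi : cinfo K i t -> stateT G t -> hist_others i t ->
      uprof G t -> noiseT G t -> R,
    expect g' (fun om : path G t.+1 => phi (comp K ((state om.1).2 i)) (state om.1).1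
      (minus i (state om.1).2) om.2.2 om.2.1) =
    expect g (fun om : path G t.+1 => phi (comp K ((state om.1).2 i)) (state om.1).1
      (minus i (state om.1).2) om.2.2 om.2.1).
Proof.
move=> tT law phi; rewrite !(expectS_others i).
transitivity (expect g' (fun om => \sum_w \sum_(u : uprof G t) noise_law G t w *
   (mixed (g i) (comp K ((state om).2 i)) (u i) *
    others_prob g (minus i (state om).2) u) *
   phi (comp K ((state om).2 i)) (state om).1 (minus i (state om).2) u w)).
  apply: eq_expect => om; apply: eq_bigr => w _; apply: eq_bigr => u _.
  by rewrite g'_self// (eq_others_prob g'_others).
rewrite (law (fun k x hm => \sum_w \sum_(u : uprof G t) noise_law G t w *
   (mixed (g i) k (u i) * others_prob g hm u) * phi k x hm u w)).
rewrite !expect_sum; apply: eq_bigr => w _; rewrite !expect_sum.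
apply: eq_bigr => u _ /=.
under eq_expect do rewrite -!mulrA mulrCA.
under [RHS]eq_expect do rewrite -!mulrA mulrCA.
by rewrite (expect_mixed (u i) (fun k x hm =>
  noise_law G t w * (others_prob g hm u * phi k x hm u w))).
Qed.

Lemma replace_law t (phi : cinfo K i t -> stateT G t -> hist_others i t -> R) :
  (t <= T)%N ->
  expect g' (fun om => phi (comp K ((state om).2 i)) (state om).1 (minus i (state om).2)) =
  expect g (fun om => phi (comp K ((state om).2 i)) (state om).1 (minus i (state om).2)).
Proof.
elim: t phi => [|t IHt] phi tT; first by [].
(* The next compression, state and others' histories are functions of the present ones, the actions
   and the noise. *)
pose next k x (hm : hist_others i t) u w :=
  let o := dyn G t x u w in
  phi (@iotaS _ _ K i t k (o.1.2 i)) o.1.1 [ffun j : others i => (hm j, o.1.2 (val j))].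
have E om : phi (comp K ((state om).2 i)) (state om).1 (minus i (state om).2) =
    next (comp K ((state om.1).2 i)) (state om.1).1 (minus i (state om.1).2) om.2.2 om.2.1.
  rewrite /next /= ffunE; congr (phi _ _ _).
  by apply/ffunP => j; rewrite !ffunE.
under eq_expect do rewrite E.
under [RHS]eq_expect do rewrite E.
by apply: law_step => // phi'; apply: IHt; exact: ltnW.
Qed.

Lemma replace_law_act t (phi : cinfo K i t -> stateT G t -> hist_others i t ->
    uprof G t -> noiseT G t -> R) :
  (t < T)%N ->
  expect g' (fun om : path G t.+1 => phi (comp K ((state om.1).2 i)) (state om.1).1
    (minus i (state om.1).2) om.2.2 om.2.1) =
  expect g (fun om : path G t.+1 => phi (comp K ((state om.1).2 i)) (state om.1).1
    (minus i (state om.1).2) om.2.2 om.2.1).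
Proof. by move=> tT; apply: law_step => // phi'; apply: replace_law; exact: ltnW. Qed.

End Replacement.
End SufficientInformation.

(** * Replacing the strategy of one player *)

Section SufficientInformation.
Local Open Scope ring_scope.
Local Open Scope classical_set_scope.
Context {R : realType} {G : game R} (K : compression G) (i : player G).
Notation I := (player G).
Notation T := (horizon G).
Context (F : strat G i -> forall t, cinfo K i t -> hist G i t -> R)
  (Phi : profile G -> forall t, cinfo K i t -> stateT G t -> hist_others i t -> R)
  (FPhi : USI_with F Phi).

Section Replacement.
Context (g g' : profile G) (vg : valid_profile g) (vg' : valid_profile g')
  (g'_others : forall j, j != i -> g' j = g j)
  (g'_self : forall t h a, (t < T)%N -> g' i t h a = mixed F (g i) (comp K h) a).
Arguments g : clear implicits.
Arguments g' : clear implicits.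

Let law_act := replace_law_act FPhi vg g'_others g'_self.

Lemma replace_payoff j : payoff g' j = payoff g j.
Proof.
suff E t : (t <= T)%N -> expect g' (fun om : path G t => rew_from 0 om j) =
    expect g (fun om : path G t => rew_from 0 om j) by exact: E.
elim: t => // t IHt tT.
rewrite !expectD !(expect_marginal (fun om => rew_from 0 om j))// IHt ?(ltnW tT)//.
by congr (_ + _); exact: law_act (fun _ x _ u w => (dyn G t x u w).2 j) tT.
Qed.

Section Other.
Context (j : I) (ji : j != i) (tau : nat) (h : hist G j tau) (a : actT G tau j).

(** As [j != i], player [j]'s history is part of [h_{-i}]; by perfect recall the event is therefore
    a function of data whose law [law_act] preserves. *)
Let event_next t (hm : hist_others i t) (u : uprof G t) : bool :=
  let hj := hm (exist _ j ji) in
  hist_event h a hj || ((Tagged (hist G j) hj == Tagged (hist G j) h) &&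
    (Tagged (fun s => actT G s j) (u j) == Tagged (fun s => actT G s j) a)).

Let event_nextE t (om : path G t.+1) : (t < T)%N ->
  event_hu h a om = event_next (minus i (state om.1).2) om.2.2.
Proof.
by move=> tT; rewrite /event_next /= !ffunE (event_huE h a om.1 (ltnW tT)).
Qed.

Let replace_event t : (t <= T)%N ->
  expect g' (fun om : path G t => (event_hu h a om)%:R) =
  expect g (fun om : path G t => (event_hu h a om)%:R).
Proof.
case: t => // t tT; under eq_expect do rewrite event_nextE//.
under [RHS]eq_expect do rewrite event_nextE//.
exact: law_act (fun _ x hm u w => (event_next hm u)%:R) tT.
Qed.

Let replace_event_rew t : (t <= T)%N ->
  expect g' (fun om : path G t => (event_hu h a om)%:R * rew_from tau om j) =
  expect g (fun om : path G t => (event_hu h a om)%:R * rew_from tau om j).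
Proof.
elim: t => // t IHt tT.
have E (om : path G t.+1) : (event_hu h a om)%:R * rew_from tau om j =
    (event_hu h a om.1)%:R * rew_from tau om.1 j +
    (event_next (minus i (state om.1).2) om.2.2)%:R *
    (if (tau <= t)%N then (dyn G t (state om.1).1 om.2.2 om.2.1).2 j else 0).
  rewrite -event_nextE// [rew_from tau om j]/= mulrDr; congr (_ + _).
  (* Up to stage [tau] no reward has been counted; afterwards the event is already decided one stage
     earlier. *)
  have [ttau|taut] := leqP t tau; last by rewrite event_hu_late.
  by rewrite rew_from_early// !mulr0.
under eq_expect do rewrite E.
under [RHS]eq_expect do rewrite E.
rewrite !expectD.
rewrite !(expect_marginal (fun om => (event_hu h a om)%:R * rew_from tau om j))//.
rewrite IHt ?(ltnW tT)//; congr (_ + _).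
exact: law_act (fun _ x hm u w => (event_next hm u)%:R *
  (if (tau <= t)%N then (dyn G t x u w).2 j else 0)) tT.
Qed.

Lemma replace_prob_hu : prob_hu g' h a = prob_hu g h a.
Proof. exact: replace_event. Qed.

Lemma replace_cond_rtg : cond_rtg g' h a = cond_rtg g h a.
Proof.
rewrite /cond_rtg replace_prob_hu; congr (_ / _).
under eq_bigr do rewrite -mulrA.
under [RHS]eq_bigr do rewrite -mulrA.
exact: replace_event_rew.
Qed.

End Other.
End Replacement.

(** * Player [i]'s decision problem as a dynamic program *)

Section Value.

Lemma kernZ g t (k : cinfo K i t) a c f :
  kern Phi g k a (fun x u w => c * f x u w) = c * kern Phi g k a f.
Proof.
rewrite mulr_sumr; apply: eq_bigr => x _; rewrite mulr_sumr.
apply: eq_bigr => hm _; rewrite mulrCA; congr (_ * _); rewrite mulr_sumr.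
apply: eq_bigr => w _; rewrite mulr_sumr; apply: eq_bigr => u _.
by rewrite mulrCA.
Qed.

Lemma kernD g t (k : cinfo K i t) a f f' :
  kern Phi g k a (fun x u w => f x u w + f' x u w) =
  kern Phi g k a f + kern Phi g k a f'.
Proof.
rewrite -big_split; apply: eq_bigr => x _ /=; rewrite -big_split.
apply: eq_bigr => hm _ /=; rewrite -mulrDr; congr (_ * _); rewrite -big_split.
apply: eq_bigr => w _ /=; rewrite -big_split; apply: eq_bigr => u _ /=.
by rewrite mulrDr.
Qed.

Lemma kern_sum g t (k : cinfo K i t) a (J : finType) (f : J -> _) :
  kern Phi g k a (fun x u w => \sum_j f j x u w) = \sum_j kern Phi g k a (f j).
Proof.
rewrite [RHS]exchange_big; apply: eq_bigr => x _ /=.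
rewrite [RHS]exchange_big; apply: eq_bigr => hm _ /=.
rewrite -mulr_sumr; congr (_ * _).
rewrite [RHS]exchange_big; apply: eq_bigr => w _ /=.
by rewrite [RHS]exchange_big; apply: eq_bigr => u _ /=; rewrite mulr_sumr.
Qed.

(* [m] counts the stages to go in [value], but only those after the current *)
(* action in [qvalue].                                                      *)
Fixpoint value (g : profile G) m t (h : hist G i t) : R :=
  if m is m'.+1 then \sum_a g i t h a * kern Phi g (comp K h) a (fun x u w =>
    (dyn G t x u w).2 i + @value g m' t.+1 (h, (dyn G t x u w).1.2 i))
  else 0.

Definition qvalue (g : profile G) m t (h : hist G i t) (a : actT G t i) : R :=
  kern Phi g (comp K h) a (fun x u w =>
    (dyn G t x u w).2 i + @value g m t.+1 (h, (dyn G t x u w).1.2 i)).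

Definition trans (g : profile G) t (k : cinfo K i t) (a : actT G t i) z : R :=
  kern Phi g k a (fun x u w => ((dyn G t x u w).1.2 i == z)%:R).

(** Isolates the dependence on [h]: the reward term and the weights [trans] see only [comp K h], and
    only the continuation value sees [h] itself. *)
Lemma qvalueE g m t (h : hist G i t) a : qvalue g m h a =
  kern Phi g (comp K h) a (fun x u w => (dyn G t x u w).2 i) +
  \sum_z trans g (comp K h) a z * @value g m t.+1 (h, z).
Proof.
rewrite /qvalue kernD; congr (_ + _).
rewrite -[RHS](eq_bigr _ (fun z _ => mulrC _ _)).
under [RHS]eq_bigr do rewrite -kernZ.
rewrite -kern_sum; apply: eq_kern_fun => x u w _.
rewrite (bigD1 ((dyn G t x u w).1.2 i))//= eqxx mulr1 big1 ?addr0// => z.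
by rewrite eq_sym => /negPf ->; rewrite mulr0.
Qed.

Definition prob_h (g : profile G) t (h : hist G i t) : R :=
  expect g (fun om => ((state om).2 i == h)%:R).

Lemma expect_event g t (h : hist G i t) a s : valid_profile g ->
  (t < s)%N -> (s <= T)%N ->
  expect g (fun om : path G s => (event_hu h a om)%:R) = prob_h g h * g i t h a.
Proof.
move=> vg; elim: s => // s IHs; rewrite ltnS leq_eqVlt => /predU1P[<- tT|ts sT].
  under eq_expect do rewrite event_hu_now -mulnb natrM.
  rewrite (expect_marginal_act (fun om => ((state om).2 i == h)%:R))//.
  rewrite -expectZr; apply: eq_expect => om.
  by case: eqP => [->|]; rewrite ?mul0r.
under eq_expect do rewrite event_hu_late//.
by rewrite (expect_marginal (fun om => (event_hu h a om)%:R))// IHs// ltnW.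
Qed.

Lemma prob_huE g t (h : hist G i t) a : valid_profile g -> (t < T)%N ->
  prob_hu g h a = prob_h g h * g i t h a.
Proof. by move=> vg tT; exact: expect_event. Qed.

(* The reward collected so far plus the expected reward to go is a martingale. *)
Lemma expect_event_rew g t (h : hist G i t) a m s : valid_profile g ->
  (t < s)%N -> (m + s)%N = T ->
  expect g (fun om : path G s =>
    (event_hu h a om)%:R * (rew_from t om i + value g m ((state om).2 i))) =
  expect g (fun om : path G T => (event_hu h a om)%:R * rew_from t om i).
Proof.
move=> vg; elim: m s => [|m IHm] s ts.
  by rewrite add0n => sT; subst s; apply: eq_expect => om /=; rewrite addr0.
rewrite addSnnS => msT; have sT : (s < T)%N by rewrite -msT leq_addl.
rewrite -(IHm s.+1)//; last exact: ltnW.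
pose f h' x (u : uprof G s) w := (hist_event h a h')%:R *
  ((dyn G s x u w).2 i + @value g m s.+1 (h', (dyn G s x u w).1.2 i)).
have E (om : path G s.+1) : (event_hu h a om)%:R *
    (rew_from t om i + value g m ((state om).2 i)) =
    (event_hu h a om.1)%:R * rew_from t om.1 i +
    f ((state om.1).2 i) (state om.1).1 om.2.2 om.2.1.
  rewrite event_hu_late// /f -(event_huE h a om.1 (ltnW sT)) -mulrDr.
  by rewrite [rew_from t om i]/= (ltnW ts) /= ffunE !addrA.
under [RHS]eq_expect do rewrite E.
rewrite expectD (expect_marginal (fun om => (event_hu h a om)%:R * rew_from t om i))//.
rewrite (expect_kern FPhi f)// -expectD; apply: eq_expect => om.
rewrite mulrDr; congr (_ + _); rewrite /= mulr_sumr; apply: eq_bigr => b _.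
by rewrite kernZ (event_huE h a om (ltnW sT)) mulrCA.
Qed.

(** At length [t.+1], [expect_event_rew] leaves the stage-[t] reward plus the next value; its mean
    is [qvalue] times [prob_h g h * g i t h a], which is exactly the denominator. *)
Lemma cond_rtgE g t (h : hist G i t) a m : valid_profile g -> (m + t.+1)%N = T ->
  0 < prob_hu g h a -> cond_rtg g h a = qvalue g m h a.
Proof.
move=> vg mT; have tT : (t < T)%N by rewrite -mT leq_addl.
rewrite /cond_rtg => p0; apply/(canLR (mulfK (lt0r_neq0 p0))).
under eq_bigr do rewrite -mulrA.
rewrite -[LHS](expect_event_rew h a vg (ltnSn t) mT) prob_huE//.
pose f h' x (u : uprof G t) w := (h' == h)%:R * ((u i == a)%:R *
  ((dyn G t x u w).2 i + @value g m t.+1 (h', (dyn G t x u w).1.2 i))).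
have E (om : path G t.+1) : (event_hu h a om)%:R *
    (rew_from t om i + value g m ((state om).2 i)) =
    f ((state om.1).2 i) (state om.1).1 om.2.2 om.2.1.
  rewrite event_hu_now -mulnb natrM /f -mulrA; congr (_ * (_ * _)).
  by rewrite [rew_from t om i]/= rew_from_early// leqnn add0r /= ffunE.
under eq_expect do rewrite E.
rewrite (expect_kern FPhi f)// [RHS]mulrC -mulrA -expectZr; apply: eq_expect => om.
under eq_bigr do rewrite kernZ mulrCA.
rewrite -mulr_sumr; have [->|] := eqVneq; last by rewrite !mul0r.
congr (_ * _); rewrite (bigD1 a)//= big1 ?addr0 => [|b /negPf ba].
  by congr (_ * _); apply: eq_kern_fun => x u w ->; rewrite eqxx mul1r.
(* The zero function is written as a product so that [kernZ] applies. *)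
rewrite (@eq_kern_fun _ _ _ _ _ _ _ _ _ _ (fun x u w => 0 * 0)) => [|x u w ->].
  by rewrite kernZ mul0r mulr0.
by rewrite ba !mul0r.
Qed.

Lemma kern_ge0 g t (k : cinfo K i t) a f : valid_profile g -> (t < T)%N ->
  (forall x u w, 0 <= f x u w) -> 0 <= kern Phi g k a f.
Proof.
move=> vg tT f0; apply: sumr_ge0 => x _; apply: sumr_ge0 => hm _.
rewrite mulr_ge0 ?(Phi_ge0 FPhi)//; apply: sumr_ge0 => w _; apply: sumr_ge0 => u _.
rewrite !mulr_ge0 ?noise_ge0//; apply: prodr_ge0 => j _.
by have [] := vg (val j) t tT (hm j).
Qed.

Lemma strat_le1 j (s : strat G j) t h a : valid_strat s -> (t < T)%N -> s t h a <= 1.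
Proof.
move=> vs tT; have [s0 <-] := vs t tT h; rewrite (bigD1 a)//= lerDl.
exact: sumr_ge0.
Qed.

Lemma trans_ge0 g t (k : cinfo K i t) a z : valid_profile g -> (t < T)%N ->
  0 <= trans g k a z.
Proof. by move=> vg tT; apply: kern_ge0. Qed.

(** A crude bound uniform in [g], enough for [cvg_bounded_mul0]: each [others_prob] is at most 1. *)
Lemma trans_le g t (k : cinfo K i t) a z : valid_profile g -> (t < T)%N ->
  trans g k a z <= #|uprof G t|%:R.
Proof.
move=> vg tT; rewrite -[leRHS]mul1r -[X in _ <= X * _](Phi_sum1 FPhi k vg tT) mulr_suml.
apply: ler_sum => x _; rewrite mulr_suml; apply: ler_sum => hm _.
apply: ler_wpM2l; first exact: (Phi_ge0 FPhi).
rewrite -[leRHS]mul1r -[X in _ <= X * _](noise_sum1 _ _ _ tT) mulr_suml; apply: ler_sum => w _.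
rewrite -sum1_card natr_sum mulr_sumr big_mkcond; apply: ler_sum => u _; rewrite mulr1.
have n0 := noise_ge0 _ _ _ tT w.
have o0 : 0 <= others_prob g hm u.
  by apply: prodr_ge0 => j _; have [] := vg (val j) t tT (hm j).
have o1 : others_prob g hm u <= 1.
  apply: prodr_ile1 => j _; have [-> _] := vg (val j) t tT (hm j).
  exact: strat_le1 (vg (val j)) tT.
case: ifP => // _; rewrite -mulrA ler_piMr// mulr_ile1//.
by case: eqP.
Qed.

Lemma prob_h_next g t (h : hist G i t) z : valid_profile g -> (t < T)%N ->
  @prob_h g t.+1 (h, z) =
  prob_h g h * \sum_a g i t h a * trans g (comp K h) a z.
Proof.
move=> vg tT.
pose f h' x (u : uprof G t) w := (h' == h)%:R * ((dyn G t x u w).1.2 i == z)%:R : R.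
transitivity (expect g (fun om : path G t.+1 =>
    f ((state om.1).2 i) (state om.1).1 om.2.2 om.2.1)).
  by apply: eq_expect => om; rewrite /f /= ffunE xpair_eqE -natrM mulnb.
rewrite (expect_kern FPhi f)// -expectZr; apply: eq_expect => om.
under eq_bigr do rewrite kernZ mulrCA.
by rewrite -mulr_sumr; have [->|] := eqVneq; last by rewrite !mul0r.
Qed.

End Value.
End SufficientInformation.

(** * Limits of fully mixed profiles *)

Section Limits.
Local Open Scope ring_scope.
Local Open Scope classical_set_scope.
Context {R : realType} {G : game R}.
Notation I := (player G).
Notation T := (horizon G).

(** Under full mixing, only the prior and the noise decide which paths have positive probability. *)
Lemma pathprob_fully_mixed (g g' : profile G) t (om : path G t) :
  fully_mixed g -> fully_mixed g' -> (t <= T)%N ->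
  0 < pathprob g om -> 0 < pathprob g' om.
Proof.
move=> [vg g0] [vg' g0']; elim: t om => // t IHt om tT /=.
have p0 := pathprob_ge0 om.1 vg (ltnW tT).
have n0 := noise_ge0 _ _ _ tT om.2.1.
rewrite pmulr_lgt0; last by apply: prodr_gt0 => j _; exact: g0.
move=> pn; rewrite pmulr_lgt0; last by apply: prodr_gt0 => j _; exact: g0'.
have np : 0 < noise_law G t om.2.1.
  by rewrite lt_neqAle n0 andbT; apply: contraTneq pn => <-; rewrite mulr0 ltxx.
move: pn; rewrite !pmulr_lgt0//; apply: IHt; exact: ltnW.
Qed.

Lemma prob_h_fully_mixed (g g' : profile G) i t (h : hist G i t) :
  fully_mixed g -> fully_mixed g' -> (t <= T)%N ->
  0 < prob_h g h -> 0 < prob_h g' h.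
Proof.
move=> fg fg' tT.
have p0 om := pathprob_ge0 om fg.1 tT; have p0' om := pathprob_ge0 om fg'.1 tT.
rewrite !lt_neqAle ![_ == prob_h _ _]eq_sym => /andP[ph _]; apply/andP; split; last first.
  by apply: sumr_ge0 => om _; rewrite mulr_ge0.
apply: contraNneq ph => ph'0; apply/eqP/big1 => om _.
have := psumr_eq0P (fun om _ => mulr_ge0 (p0' om) (ler0n _ _)) ph'0 (i := om) isT.
case: eqP => [_|_ _]; last by rewrite mulr0.
rewrite !mulr1 => po'; apply/eqP; rewrite eq_le p0 andbT leNgt; apply/negP.
by move=> /(pathprob_fully_mixed fg fg' tT); rewrite po' ltxx.
Qed.

Lemma pathprob_cvg (gs : nat -> profile G) (g : profile G) :
  (forall i t, (t < T)%N -> forall (h : hist G i t) (u : actT G t i),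
     (fun n => gs n i t h u) @ \oo --> g i t h u) ->
  forall t (om : path G t), (t <= T)%N ->
  (fun n => pathprob (gs n) om) @ \oo --> pathprob g om.
Proof.
move=> gsg; elim=> [|t IHt] om tT; first exact: cvg_cst.
apply: cvgM; first by apply: cvgM; [apply: IHt; exact: ltnW | exact: cvg_cst].
by apply: cvg_bigprod => j _; exact: gsg.
Qed.

Lemma payoff_cvg (gs : nat -> profile G) (g : profile G) :
  (forall i t, (t < T)%N -> forall (h : hist G i t) (u : actT G t i),
     (fun n => gs n i t h u) @ \oo --> g i t h u) ->
  forall j, (fun n => payoff (gs n) j) @ \oo --> payoff g j.
Proof.
move=> gsg j; apply: cvg_bigsum => om _.
by apply: cvgM; [exact: pathprob_cvg | exact: cvg_cst].
Qed.

Lemma valid_profile_cvg (gs : nat -> profile G) (g : profile G) :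
  (forall n, valid_profile (gs n)) ->
  (forall i t, (t < T)%N -> forall (h : hist G i t) (u : actT G t i),
     (fun n => gs n i t h u) @ \oo --> g i t h u) -> valid_profile g.
Proof.
move=> vgs gsg i t tT h; split => [u|].
  by apply: cvg_seq_ge0 (gsg i t tT h u) => n; have [] := vgs n i t tT h.
apply: cvg_seq_unique; last exact: cvg_cst.
rewrite [X in X @ \oo](_ : _ = (fun n => \sum_u gs n i t h u)).
  by apply: cvg_bigsum => u _; exact: gsg.
by apply/funext => n; have [_ ->] := vgs n i t tT h.
Qed.

End Limits.

(** * [F] as a conditional law, and its averages *)

Section OnePlayerReplacement.
Local Open Scope ring_scope.
Local Open Scope classical_set_scope.
Context {R : realType} {G : game R} (K : compression G) (i : player G).
Notation I := (player G).
Notation T := (horizon G).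
Context (F : strat G i -> forall t, cinfo K i t -> hist G i t -> R)
  (Phi : profile G -> forall t, cinfo K i t -> stateT G t -> hist_others i t -> R)
  (FPhi : USI_with F Phi).

(** Bayes' rule for [F]: when [k] has positive probability, [F] vanishes at histories that compress
    elsewhere or have probability zero. *)
Lemma prob_kF g t (k : cinfo K i t) (h : hist G i t) :
  valid_profile g -> (t < T)%N ->
  prob_k g k * F (g i) k h = (comp K h == k)%:R * prob_h g h.
Proof.
move=> vg tT; have := expect_comp FPhi k (fun h' _ _ => (h' == h)%:R) vg tT.
have -> : \sum_h' F (g i) k h' * \sum_x \sum_hm Phi g k x hm * (h' == h)%:R =
    F (g i) k h.
  rewrite (bigD1 h)//= eqxx [X in _ + X]big1 ?addr0 => [|h' /negPf ->].
    under eq_bigr do under eq_bigr do rewrite mulr1.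
    by rewrite (Phi_sum1 FPhi)// mulr1.
  by rewrite big1 ?mulr0// => x _; rewrite big1// => hm _; rewrite mulr0.
move=> <-; rewrite mulrC -expectZr; apply: eq_expect => om.
by case: (eqVneq _ h) => [->|]; rewrite ?mulr0 ?mul0r ?mulr1 ?mul1r.
Qed.

Lemma mixed_sum1 s t (k : cinfo K i t) : valid_strat s -> (t < T)%N ->
  \sum_a mixed F s k a = 1.
Proof.
move=> vs tT; rewrite exchange_big /= -(F_sum1 FPhi k vs tT).
by apply: eq_bigr => h _; rewrite -mulr_sumr; have [_ ->] := vs t tT h; rewrite mulr1.
Qed.

Lemma mixed_ge0 s t (k : cinfo K i t) a : valid_strat s -> (t < T)%N ->
  0 <= mixed F s k a.
Proof.
move=> vs tT; apply: sumr_ge0 => h _; rewrite mulr_ge0 ?(F_ge0 FPhi)//.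
by have [] := vs t tT h.
Qed.

Lemma mixed_le1 s t (k : cinfo K i t) a : valid_strat s -> (t < T)%N ->
  mixed F s k a <= 1.
Proof.
move=> vs tT; rewrite -(mixed_sum1 k vs tT) (bigD1 a)//= lerDl.
by apply: sumr_ge0 => *; exact: mixed_ge0.
Qed.

Lemma mixed_gt0 s t (k : cinfo K i t) a : valid_strat s -> (t < T)%N ->
  (forall h, 0 < s t h a) -> 0 < mixed F s k a.
Proof.
move=> vs tT s0; rewrite lt_neqAle mixed_ge0// andbT eq_sym.
apply/eqP => /psumr_eq0P m0; have := F_sum1 FPhi k vs tT.
rewrite big1 => [/eqP|h _]; first by rewrite eq_sym oner_eq0.
have /eqP := m0 (fun h _ => mulr_ge0 (F_ge0 FPhi k h vs tT) (ltW (s0 h))) h isT.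
by rewrite mulf_eq0 (gt_eqF (s0 h)) orbF => /eqP.
Qed.

End OnePlayerReplacement.

(** * Passing to the limit in the replacement of one player *)

Section LimitReplacement.
Local Open Scope ring_scope.
Local Open Scope classical_set_scope.
Context {R : realType} {G : game R} (K : compression G) (i : player G).
Notation I := (player G).
Notation T := (horizon G).
Context (F : strat G i -> forall t, cinfo K i t -> hist G i t -> R)
  (Phi : profile G -> forall t, cinfo K i t -> stateT G t -> hist_others i t -> R)
  (FPhi : USI_with F Phi).
Context (gs : nat -> profile G) (Qs : nat -> qfun G) (g : profile G) (Q : qfun G).
Arguments gs : clear implicits.
Arguments Qs : clear implicits.
Arguments g : clear implicits.
Arguments Q : clear implicits.
Context (mixed_gs : forall n, fully_mixed (gs n))
  (gs_cvg : forall j t, (t < T)%N -> forall (h : hist G j t) (u : actT G t j),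
    (fun n => gs n j t h u) @ \oo --> g j t h u)
  (Qs_cvg : forall j t, (t < T)%N -> forall (h : hist G j t) (u : actT G t j),
    (fun n => Qs n j t h u) @ \oo --> Q j t h u)
  (QsE : forall n, Q_of (gs n) (Qs n))
  (g_rational : seq_rational g Q).
Context (rho : forall t, cinfo K i t -> actT G t i -> R).
Arguments rho : clear implicits.
Context (rho_cvg : forall t (k : cinfo K i t) a, (t < T)%N ->
    (fun n => mixed F (gs n i) k a) @ \oo --> rho t k a).

Let replace (f : profile G) (s : strat G i) : profile G := @dfwith I (strat G) f i s.
Arguments replace : clear implicits.
Let replace_self f s : replace f s i = s. Proof. exact: dfwithin. Qed.
Let replace_other f s j : j != i -> replace f s j = f j.
Proof. by move=> ji; apply: dfwithout; rewrite eq_sym. Qed.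

Definition replaced_seq n : profile G :=
  replace (gs n) (fun t h a => mixed F (gs n i) (comp K h) a).
Definition replaced : profile G := replace g (fun t h a => rho t (comp K h) a).

Arguments replaced_seq : clear implicits.
Arguments replaced : clear implicits.

Notation gs' := replaced_seq.
Notation g' := replaced.

Let valid_gs n : valid_profile (gs n). Proof. exact: (mixed_gs n).1. Qed.

Let valid_g : valid_profile g. Proof. exact: valid_profile_cvg valid_gs gs_cvg. Qed.

Let gs'_self n t h a : gs' n i t h a = mixed F (gs n i) (comp K h) a.
Proof. by rewrite /gs' replace_self. Qed.

Let gs'_other n j : j != i -> gs' n j = gs n j.
Proof. exact: replace_other. Qed.

Lemma fully_mixed_replaced n : fully_mixed (gs' n).
Proof.
split=> j; have [->|ji] := eqVneq j i => t tT h; last first.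
- by move=> u; rewrite gs'_other//; exact: (mixed_gs n).2.
- move=> u; rewrite gs'_self (mixed_gt0 FPhi)// => [|h']; first exact: valid_gs.
  exact: (mixed_gs n).2.
- by rewrite gs'_other//; exact: valid_gs.
- split=> [u|]; first by rewrite gs'_self (mixed_ge0 FPhi)//; exact: valid_gs.
  by under eq_bigr do rewrite gs'_self; rewrite (mixed_sum1 FPhi)//; exact: valid_gs.
Qed.

Lemma replaced_cvg j t : (t < T)%N -> forall (h : hist G j t) (u : actT G t j),
  (fun n => gs' n j t h u) @ \oo --> g' j t h u.
Proof.
have [->|ji] := eqVneq j i => tT h u.
  rewrite /g' replace_self [X in X @ \oo](_ : _ =
    (fun n => mixed F (gs n i) (comp K h) u)); first exact: rho_cvg.
  by apply/funext => n; rewrite gs'_self.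
rewrite /g' replace_other// [X in X @ \oo](_ : _ = (fun n => gs n j t h u)).
  exact: gs_cvg.
by apply/funext => n; rewrite gs'_other.
Qed.

Let valid_gs' n : valid_profile (gs' n). Proof. exact: (fully_mixed_replaced n).1. Qed.

Let valid_g' : valid_profile g'. Proof. exact: valid_profile_cvg valid_gs' replaced_cvg. Qed.

Lemma payoff_replaced j : payoff g' j = payoff g j.
Proof.
have := payoff_cvg replaced_cvg (j := j).
rewrite [X in X @ \oo --> _ -> _](_ : _ = (fun n => payoff (gs n) j)) => [p'|].
  exact: cvg_seq_unique p' (payoff_cvg gs_cvg (j := j)).
by apply/funext => n; apply: (replace_payoff FPhi) => // k; exact: gs'_other.
Qed.

(** The index 0 is arbitrary: by [prob_h_fully_mixed] every fully mixed profile gives the same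
    notion. *)
Definition reach t (h : hist G i t) : bool := 0 < prob_h (gs 0) h.

Let reachP n t (h : hist G i t) : (t <= T)%N -> reach h -> 0 < prob_h (gs n) h.
Proof. by move=> tT; exact: prob_h_fully_mixed. Qed.

Let reachP' n t (h : hist G i t) : (t <= T)%N -> reach h -> 0 < prob_h (gs' n) h.
Proof.
move=> tT; apply: prob_h_fully_mixed => //; exact: fully_mixed_replaced.
Qed.

Let reach_next n t (h : hist G i t) a z : (t < T)%N -> reach h ->
  0 < trans Phi (gs n) (comp K h) a z -> @reach t.+1 (h, z).
Proof.
move=> tT rh tr; apply: (prob_h_fully_mixed (mixed_gs n)) => //.
rewrite (prob_h_next FPhi)// mulr_gt0 ?(reachP n (ltnW tT) rh)//.
rewrite (bigD1 a)//= ltr_pwDl// ?mulr_gt0//; first exact: (mixed_gs n).2.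
apply: sumr_ge0 => b _; rewrite mulr_ge0 ?(trans_ge0 FPhi)//.
exact/ltW/(mixed_gs n).2.
Qed.

Let q n := qvalue Phi (gs n).
Let q' n := qvalue Phi (gs' n).

Let Qs_qvalue n m t (h : hist G i t) a : (m + t.+1)%N = T -> reach h ->
  Qs n i t h a = q n m h a.
Proof.
move=> mT rh; have tT : (t < T)%N by rewrite -mT leq_addl.
have p0 : 0 < prob_hu (gs n) h a.
  rewrite prob_huE// mulr_gt0 ?(reachP n (ltnW tT) rh)//.
  exact: (mixed_gs n).2.
by rewrite QsE// (cond_rtgE FPhi (valid_gs n) mT).
Qed.

Let q_cvg m t (h : hist G i t) a : (m + t.+1)%N = T -> reach h ->
  (fun n => q n m h a) @ \oo --> Q i t h a.
Proof.
move=> mT rh; have tT : (t < T)%N by rewrite -mT leq_addl.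
rewrite [X in X @ \oo](_ : _ = (fun n => Qs n i t h a)); first exact: Qs_cvg.
by apply/funext => n; rewrite (Qs_qvalue n a mT rh).
Qed.

(** Convergence of [d z] is needed only at successors that some [gs n] reaches; the other weights
    are identically zero. *)
Let trans_cvg0 t (h : hist G i t) a (d : infoT G t i -> nat -> R) :
  (t < T)%N ->
  (forall n z, 0 < trans Phi (gs n) (comp K h) a z -> d z @ \oo --> (0 : R)) ->
  (fun n => \sum_z trans Phi (gs n) (comp K h) a z * d z n) @ \oo --> (0 : R).
Proof.
move=> tT d0; apply: cvg_bigsum0 => z.
have [[n tn]|/forallNP tr0] := pselect (exists n, 0 < trans Phi (gs n) (comp K h) a z).
  apply: (@cvg_bounded_mul0 _ _ _ #|uprof G t|%:R) (d0 n z tn) => k.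
  by rewrite (trans_ge0 FPhi)// (trans_le FPhi).
rewrite [X in X @ \oo](_ : _ = fun=> 0); first exact: cvg_cst.
apply/funext => n; rewrite (_ : trans _ _ _ _ _ = 0) ?mul0r//.
by apply/eqP; rewrite eq_le (trans_ge0 FPhi)// andbT leNgt; apply/negP/tr0.
Qed.

(* The hypothesis of the backward induction, with [m] stages to go. *)
Let values_agree m t :=
  (forall h h' : hist G i t, reach h -> reach h' -> comp K h = comp K h' ->
     (fun n => value Phi (gs n) m h - value Phi (gs n) m h') @ \oo --> (0 : R)) /\
  (forall h : hist G i t, reach h ->
     (fun n => value Phi (gs' n) m h - value Phi (gs n) m h) @ \oo --> (0 : R)).

(** By [qvalueE] the two values differ only through continuation values at reachable successors with
    equal compressions, and these differences tend to 0. *)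
Let Q_comp m t (h h' : hist G i t) a : (m + t.+1)%N = T -> values_agree m t.+1 ->
  reach h -> reach h' -> comp K h = comp K h' -> Q i t h a = Q i t h' a.
Proof.
move=> mT [va _] rh rh' hh'; have tT : (t < T)%N by rewrite -mT leq_addl.
apply/eqP; rewrite -subr_eq0; apply/eqP.
apply: (@cvg_seq_unique _ (fun n => q n m h a - q n m h' a)).
  by apply: cvgB; exact: q_cvg.
rewrite [X in X @ \oo](_ : _ = (fun n => \sum_z trans Phi (gs n) (comp K h) a z *
    (@value _ _ _ _ Phi (gs n) m t.+1 (h, z) - @value _ _ _ _ Phi (gs n) m t.+1 (h', z)))).
  apply: (trans_cvg0 (d := fun z n => @value _ _ _ _ Phi (gs n) m t.+1 (h, z) -
    @value _ _ _ _ Phi (gs n) m t.+1 (h', z))) => // n z tr.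
  apply: va; [exact: reach_next tr| |by rewrite /= hh'].
  by apply: (reach_next (n := n) (a := a)) => //; rewrite -hh'.
apply/funext => n; rewrite /q !qvalueE hh' opprD addrACA subrr add0r -sumrB.
by apply: eq_bigr => z _; rewrite mulrBr.
Qed.

(** [gs' n] and [gs n] have the same kernels by [eq_kern], so again only continuation values
    differ. *)
Let q'_cvg m t (h : hist G i t) a : (m + t.+1)%N = T -> values_agree m t.+1 ->
  reach h -> (fun n => q' n m h a) @ \oo --> Q i t h a.
Proof.
move=> mT [_ va] rh; have tT : (t < T)%N by rewrite -mT leq_addl.
apply: (@cvg_sub0 _ _ _ _ _ _ (fun n => q n m h a)); last exact: q_cvg.
rewrite [X in X @ \oo](_ : _ = (fun n => \sum_z trans Phi (gs n) (comp K h) a z *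
    (@value _ _ _ _ Phi (gs' n) m t.+1 (h, z) - @value _ _ _ _ Phi (gs n) m t.+1 (h, z)))).
  apply: (trans_cvg0 (d := fun z n => @value _ _ _ _ Phi (gs' n) m t.+1 (h, z) -
    @value _ _ _ _ Phi (gs n) m t.+1 (h, z))) => // n z tr.
  by apply: va; exact: reach_next tr.
apply/funext => n; rewrite -[LHS]/(qvalue Phi (gs' n) m h a - qvalue Phi (gs n) m h a).
rewrite !qvalueE /trans.
under eq_bigr do rewrite (eq_kern FPhi _ _ _ (fun j => @gs'_other n j)).
rewrite (eq_kern FPhi _ _ _ (fun j => @gs'_other n j)) opprD addrACA subrr add0r -sumrB.
by apply: eq_bigr => z _; rewrite mulrBr.
Qed.

(** If [a] is not maximal at [h], then by [Q_comp] it is not maximal at any reachable [h'] with the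
    same compression, so [g] gives it probability 0 there and every term of the average [mixed]
    tends to 0. *)
Let rho_rational m t (h : hist G i t) a : (m + t.+1)%N = T -> values_agree m t.+1 ->
  reach h -> 0 < rho t (comp K h) a -> forall b, Q i t h b <= Q i t h a.
Proof.
move=> mT va rh rho0 b; have tT : (t < T)%N by rewrite -mT leq_addl.
rewrite leNgt; apply/negP => ab; move: rho0.
suff -> : rho t (comp K h) a = 0 by rewrite ltxx.
apply: (cvg_seq_unique (rho_cvg (k := comp K h) (a := a) tT)).
apply: cvg_bigsum0 => h'.
have [/andP[/eqP hh' rh']|nrh] := boolP ((comp K h' == comp K h) && reach h').
  apply: (@cvg_bounded_mul0 _ _ _ 1) => [n|].
    by rewrite (F_ge0 FPhi) ?(F_le1 FPhi)//; exact: valid_gs.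
  suff <- : g i t h' a = 0 by exact: gs_cvg.
  apply/eqP; rewrite eq_le; have [-> _] := @valid_g i t tT h'; rewrite andbT leNgt.
  apply/negP => ga; have := g_rational tT ga b.
  by rewrite !(Q_comp _ mT va rh' rh hh') leNgt ab.
rewrite [X in X @ \oo](_ : _ = fun=> 0); first exact: cvg_cst.
apply/funext => n.
(* [h] is reachable and compresses to this value, so [prob_kF] forces [F] to be zero at [h']. *)
have pk : 0 < prob_k (gs n) (comp K h).
  apply: lt_le_trans (reachP n (ltnW tT) rh) _; apply: ler_sum => om _.
  apply: ler_wpM2l; first exact: pathprob_ge0 (ltnW tT).
  by case: eqP => [->|_]; rewrite ?eqxx.
have := prob_kF FPhi (comp K h) h' (valid_gs n) tT.
rewrite [RHS](_ : _ = 0).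
  by move/eqP; rewrite mulf_eq0 (gt_eqF pk) /= => /eqP ->; rewrite mul0r.
move: nrh; case: eqP => _ /=; last by rewrite mul0r.
move=> nrh; apply/eqP; rewrite mul1r eq_le -[_ <= 0]negbK -ltNge.
rewrite (contra _ nrh) /=; first by apply: (expect_ge0 (valid_gs n) (ltnW tT)).
by apply: prob_h_fully_mixed => //; exact: ltnW.
Qed.

(** Both value sequences converge to means of [Q] under laws supported on its maximizers, hence to
    its maximum, which depends only on the compression. *)
Let values_agree_all m t : (m + t)%N = T -> values_agree m t.
Proof.
elim: m t => [|m IHm] t.
  move=> _; split=> *; rewrite [X in X @ \oo](_ : _ = fun=> 0) ?subrr//.
  - exact: cvg_cst.
  - by apply/funext => n /=; rewrite subrr.
  - exact: cvg_cst.
  - by apply/funext => n /=; rewrite subrr.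
rewrite addSnnS => mT; have tT : (t < T)%N by rewrite -mT leq_addl.
have va := IHm _ mT.
have value_cvg (h : hist G i t) : reach h ->
    (fun n => value Phi (gs n) m.+1 h) @ \oo --> \sum_a g i t h a * Q i t h a.
  move=> rh; apply: cvg_bigsum => a _; apply: cvgM; first exact: gs_cvg.
  exact: q_cvg mT rh.
have value'_cvg (h : hist G i t) : reach h ->
    (fun n => value Phi (gs' n) m.+1 h) @ \oo --> \sum_a g' i t h a * Q i t h a.
  move=> rh; apply: cvg_bigsum => a _; apply: cvgM; first exact: replaced_cvg.
  exact: q'_cvg mT va rh.
have [[g0 g1] [g'0 g'1]] :
  ((forall h u, 0 <= g i t h u) /\ (forall h, \sum_u g i t h u = 1)) /\
  ((forall h u, 0 <= g' i t h u) /\ (forall h, \sum_u g' i t h u = 1)).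
  by split; split=> h; by [have [] := @valid_g i t tT h |
    have [] := @valid_g' i t tT h].
split=> [h h' rh rh' hh'|h rh].
  rewrite -(subrr (\sum_a g i t h' a * Q i t h' a)).
  apply: cvgB; last exact: value_cvg.
  suff <- : \sum_a g i t h a * Q i t h a = \sum_a g i t h' a * Q i t h' a.
    exact: value_cvg.
  rewrite [RHS](_ : _ = \sum_a g i t h' a * Q i t h a); last first.
    by apply: eq_bigr => a _; rewrite (Q_comp a mT va rh rh' hh').
  apply: argmax_mean_eq => // a ga b; first exact: g_rational.
  by rewrite !(Q_comp _ mT va rh rh' hh'); exact: g_rational.
rewrite -(subrr (\sum_a g i t h a * Q i t h a)).
apply: cvgB; last exact: value_cvg.
suff -> : \sum_a g i t h a * Q i t h a = \sum_a g' i t h a * Q i t h a.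
  exact: value'_cvg.
apply: argmax_mean_eq => // a ga b; first exact: g_rational.
by apply: (rho_rational mT va rh); move: ga; rewrite /g' replace_self.
Qed.

Lemma seq_eq_replaced : exists Q', seq_eq g' Q'.
Proof.
have toT t : (t < T)%N -> (T - t.+1 + t.+1)%N = T by exact: subnK.
have va t (tT : (t < T)%N) := values_agree_all (toT _ tT).
pose Q' : qfun G := @dfwith I (fun j => forall t, hist G j t -> actT G t j -> R) Q i
  (fun t h a => if reach h then Q i t h a else 0).
pose Qs' n : qfun G :=
  @dfwith I (fun j => forall t, hist G j t -> actT G t j -> R) (Qs n) i
  (fun t h a => if reach h then cond_rtg (gs' n) h a else 0).
have Q'i : Q' i = (fun t h a => if reach h then Q i t h a else 0) by exact: dfwithin.
have Q'j j : j != i -> Q' j = Q j by move=> ji; apply: dfwithout; rewrite eq_sym.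
have Qs'i n : Qs' n i = (fun t h a => if reach h then cond_rtg (gs' n) h a else 0).
  exact: dfwithin.
have Qs'j n j : j != i -> Qs' n j = Qs n j.
  by move=> ji; apply: dfwithout; rewrite eq_sym.
exists Q'; split; first exact: valid_g'; split.
  move=> j; have [->|ji] := eqVneq j i => t tT h u; last first.
    by rewrite Q'j// /g' replace_other//; exact: g_rational.
  (* At unreachable histories [Q'] is constant, so every action is a maximizer. *)
  rewrite Q'i /g' replace_self => rho0 u'; case: ifP => // rh.
  exact: rho_rational (toT _ tT) (va _ tT) rh rho0 u'.
exists gs', Qs'; split; first exact: fully_mixed_replaced.
split; first exact: replaced_cvg.
split.
  move=> j t tT; have [->|ji] := eqVneq j i => h u; last first.
    rewrite Q'j// [X in X @ \oo](_ : _ = (fun n => Qs n j t h u)); first exact: Qs_cvg.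
    by apply/funext => n; rewrite Qs'j.
  rewrite Q'i; have [rh|nrh] := boolP (reach h); last first.
    rewrite [X in X @ \oo](_ : _ = fun=> 0); first exact: cvg_cst.
    by apply/funext => n; rewrite Qs'i (negPf nrh).
  rewrite [X in X @ \oo](_ : _ = (fun n => q' n (T - t.+1) h u)).
    exact: q'_cvg (toT _ tT) (va _ tT) rh.
  apply/funext => n; rewrite Qs'i rh.
  rewrite (cond_rtgE FPhi (valid_gs' n) (toT _ tT))//.
  rewrite prob_huE// mulr_gt0 ?(reachP' n (ltnW tT) rh)//.
  exact: (fully_mixed_replaced n).2.
move=> n j t tT; have [->|ji] := eqVneq j i => h a; last first.
  rewrite (replace_prob_hu FPhi (valid_gs n) (fun k => @gs'_other n k)
    (fun t h a _ => gs'_self n h a) ji).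
  rewrite (replace_cond_rtg FPhi (valid_gs n) (valid_gs' n) (fun k => @gs'_other n k)
    (fun t h a _ => gs'_self n h a) ji).
  by rewrite Qs'j//; exact: QsE.
rewrite prob_huE// Qs'i => p0.
suff -> : reach h by [].
(* A pair of positive probability under [gs' n] has a reachable history, so the default 0 is never
   tested. *)
apply: (prob_h_fully_mixed (fully_mixed_replaced n)) => //; first exact: ltnW.
by move: p0; rewrite pmulr_lgt0//; exact: (fully_mixed_replaced n).2.
Qed.

End LimitReplacement.

(** * Replacing all players *)

Section KBasedEquilibria.
Local Open Scope ring_scope.
Local Open Scope classical_set_scope.
Context {R : realType} {G : game R} (K : compression G).
Notation I := (player G).
Notation T := (horizon G).

Definition K_based_strat i (s : strat G i) : Prop :=
  exists rho : forall t, cinfo K i t -> actT G t i -> R,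
    forall t, (t < T)%N -> forall (h : hist G i t) (u : actT G t i),
      s t h u = rho t (comp K h) u.

Lemma K_based_replacement i (g : profile G) (Q : qfun G) :
  USI K i -> seq_eq g Q ->
  exists (g' : profile G) (Q' : qfun G),
    [/\ seq_eq g' Q', forall j, j != i -> g' j = g j, K_based_strat (g' i) &
        forall j, payoff g' j = payoff g j].
Proof.
move=> [F [Phi FPhi]] [vg [gQ [gs [Qs [fm [gsg [QsQ QsE]]]]]]].
(* The averaged strategies before the horizon have finitely many coordinates, all in [[0, 1]]. *)
pose X : finType := {t : 'I_T & (cinfo K i t * actT G t i)%type}.
pose u (x : X) n := mixed F (gs n i) (tagged x).1 (tagged x).2.
have [|f foo [l ul]] := @bolzano_weierstrass_fin R X u.
  move=> [t [k a]]; exists 1; split => // M M1 n _ /=.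
  apply: le_trans (ltW M1); have vs := (fm n).1 i.
  by rewrite ger0_norm ?(mixed_le1 FPhi) ?(mixed_ge0 FPhi).
(* [limn] defines the limit at every [t], whereas [l] exists only for [t] below the horizon. *)
pose rho t (k : cinfo K i t) (a : actT G t i) :=
  limn (fun n => mixed F (gs (f n) i) k a).
have rho_cvg t (k : cinfo K i t) a : (t < T)%N ->
    (fun n => mixed F (gs (f n) i) k a) @ \oo --> rho t k a.
  move=> tT; apply/cvg_ex.
  by exists (l (Tagged (fun t : 'I_T => (cinfo K i t * actT G t i)%type)
    ((k, a) : cinfo K i (Ordinal tT) * actT G (Ordinal tT) i))); exact: ul.
have fm' n : fully_mixed (gs (f n)) by [].
have gsg' j t (tT : (t < T)%N) (h : hist G j t) (a : actT G t j) :
    (fun n => gs (f n) j t h a) @ \oo --> g j t h a.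
  exact: cvg_comp foo (gsg j t tT h a).
have QsQ' j t (tT : (t < T)%N) (h : hist G j t) (a : actT G t j) :
    (fun n => Qs (f n) j t h a) @ \oo --> Q j t h a.
  exact: cvg_comp foo (QsQ j t tT h a).
have [Q' eqQ'] := seq_eq_replaced FPhi fm' gsg' QsQ' (fun n => QsE (f n)) gQ rho_cvg.
exists (replaced g rho), Q'; split=> //.
- by move=> j ji; apply: dfwithout; rewrite eq_sym.
- by exists rho => t tT h a; rewrite /replaced dfwithin.
- by move=> j; exact: (payoff_replaced FPhi fm' gsg' rho_cvg).
Qed.

Lemma K_based_strats (g : profile G) :
  (forall i, K_based_strat (g i)) -> K_based K g.
Proof.
move=> gK; exists (fun i => projT1 (cid (gK i))) => i.
exact: (projT2 (cid (gK i))).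
Qed.

(** Each replacement leaves the other strategies untouched, so players already treated stay
    [K]-based. *)
Lemma K_based_equilibrium (g : profile G) (Q : qfun G) :
  (forall i, USI K i) -> seq_eq g Q ->
  exists (g' : profile G) (Q' : qfun G),
    [/\ seq_eq g' Q', K_based K g' & forall j, payoff g' j = payoff g j].
Proof.
move=> usi gQ.
suff [g' [Q' [gQ' gK' pg']]] : exists (g' : profile G) (Q' : qfun G),
    [/\ seq_eq g' Q', forall i, i \in enum I -> K_based_strat (g' i) &
        forall j, payoff g' j = payoff g j].
  exists g', Q'; split=> //; apply: K_based_strats => i.
  by apply: gK'; rewrite mem_enum.
elim: (enum I) => [|i s [g' [Q' [gQ' gK' pg']]]]; first by exists g, Q.
have [g'' [Q'' [gQ'' g''j g''i pg'']]] := K_based_replacement (usi i) gQ'.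
exists g'', Q''; split=> // [j|j]; last by rewrite pg''.
have [->//|ji] := eqVneq j i.
by rewrite inE (negPf ji) /= => js; rewrite g''j//; exact: gK'.
Qed.

End KBasedEquilibria.

Theorem theorem4 (R : realType) (G : game R) (K : compression G) :
  (forall i : player G, USI K i) ->
  forall v : player G -> R,
    (exists (g : profile G) (Q : qfun G),
        seq_eq g Q /\ K_based K g /\ forall i, payoff g i = v i) <->
    (exists (g : profile G) (Q : qfun G),
        seq_eq g Q /\ forall i, payoff g i = v i).
Proof.
move=> usi v; split=> [[g [Q [gQ [_ gv]]]]|[g [Q [gQ gv]]]]; first by exists g, Q.
have [g' [Q' [gQ' gK' pg']]] := K_based_equilibrium usi gQ.
by exists g', Q'; do !split=> //; move=> i; rewrite pg'.
Qed.
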